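(* Let $k,\ell\ge 1$ be integers, $d=\ell k$, and let $\mathcal H_A=\mathcal H_B=\mathbb C^d$ with computational basis $\{|x\rangle\}_{x=0}^{d-1}$. Consider the subspace-QKD protocol (described in the context) with subspaces of size $k$, run under collective attacks, where in every round Eve distributes the same state $\rho_{AB}$ on $\mathcal H_A\otimes\mathcal H_B$ and holds a purification $|\psi_{ABE}\rangle$ of it. For $m=0,\dots,\ell-1$ let $\Pi^m=\sum_{i=0}^{k-1}|mk+i\rangle\langle mk+i|$, and write $\Pi^m_A,\Pi^m_B$ for this projector acting on $\mathcal H_A,\mathcal H_B$. Then the asymptotic key rate $K_{TOT}$ of the protocol satisfies $$K_{TOT}\;\ge\;\sum_{m=0}^{\ell-1}p(M=m)\Big(H(X'|E)_{\tilde\rho^m}-H(X'|Y')_{\tilde\rho^m}\Big),$$ where $$p(M=m)=\mathrm{Tr}\big((\Pi^m_A\otimes\Pi^m_B)\,\rho_{AB}\big),$$ and (for $p(M=m)>0$; terms with $p(M=m)=0$ are taken to be $0$) the entropies are evaluated on the state $$\tilde\rho^m_{X'Y'E}=(\mathcal E^{\mathcal M}_{X'Y'\leftarrow AB}\otimes \mathrm{id}_E)\big(|\tilde\psi^m_{ABE}\rangle\langle\tilde\psi^m_{ABE}|\big),$$ in which $|\tilde\psi^m_{ABE}\rangle$ is a purification, with purifying system $E$, of $$\rho^m_{AB}=\frac{(\Pi^m_A\otimes\Pi^m_B)\,\rho_{AB}\,(\Pi^m_A\otimes\Pi^m_B)}{p(M=m)},$$ and $\mathcal E^{\mathcal M}_{X'Y'\leftarrow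 AB}$ is the key-generation measurement: Alice and Bob both measure in the computational basis, obtaining $x=mk+x'$ and $y=mk+y'$, and record $x',y'\in\{0,\dots,k-1\}$ in classical registers $X',Y'$.
   Context: All systems are finite-dimensional. $H(\cdot|\cdot)$ is the conditional von Neumann entropy (base 2) of the indicated state; it reduces to the conditional Shannon entropy for classical registers. Measurements. $A_1^x=|x\rangle\langle x|$ and $B_1^y=|y\rangle\langle y|$ are the projectors onto the computational bases. The second measurements are $A_2^x=UA_1^xU^\dagger$ and $B_2^y=U^*B_1^yU^{\top}$, where $U=\frac1{\sqrt k}\sum_{m=0}^{\ell-1}\sum_{i,j=0}^{k-1}\omega_k^{ij}|mk+i\rangle\langle mk+j|$, $\omega_k=e^{2\pi \mathrm i/k}$. An outcome $x=mk+i$ with $0\le i\le k-1$ is interpreted as outcome $i$ in the $m$-th subspace. Subspace-QKD protocol. (1) Distribution: a source distributes $\rho_{AB}$ to Alice and Bob. (2) Measurement: Alice and Bob independently choose random bits $w_A,w_B$ with $p(w_A=1)=p(w_B=1)=\varepsilon\ll1$; Alice measures $\{A_1^x\}$ if $w_A=0$ and $\{A_2^x\}$ if $w_A=1$, Bob analogously with $\{B_1^y\}$, $\{B_2^y\}$; outcomes are recorded in $X,Y$. Steps (1)-(2) are repeated $N$ times. (3) Sifting and subspace selection: over a public authenticated classical channel they reveal basis choices and the indices $m_A,m_B$ of the subspaces containing their outcomes. If $m_A=m_B=m$ and $w_A=w_B$ they set $M=m$, $x'=x-mk$, $y'=y-mk$; otherwise they set $M=\perp$, $x'=y'=\perp$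 and discard the round. (4) Parameter estimation: the second-basis outcomes and some of the first-basis outcomes are used to estimate correlations for each $M=m$; the remaining first-basis outcomes form the raw key. (5) Information reconciliation and privacy amplification are performed in each subspace to extract the final key. Key rate. The asymptotic key rate is the limit, as $N\to\infty$, of the achievable number of secret key bits per round; in this limit $\varepsilon$ may be taken arbitrarily close to $0$, so the cost of test rounds and basis sifting is disregarded. Collective attacks means Eve attacks each round identically and independently and may measure her systems at any later time; the public value of $M$ is also available to her. Fair sampling, access to local randomness and a public authenticated classical channel are assumed. The known result (Devetak-Winter, Renner) taken as given is that under collective attacks the asymptotic key rate is at least $H(X|E_T)-H(X|Y)$, where $X,Y$ are Alice's and Bob's (classical) raw-key data of a round and $E_T$ is all information available to Eve before information reconciliation. For the present protocol this means $K_{TOT}\ge H(X'|EM)-H(X'|Y'M)$, evaluated on the state of one key-generation round after step (3), where Eve's quantum system $E$ purifies $\rho_{AB}$ and $M\in\{0,\dots,\ell-1,\perp\}$. *)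

(* Defs.v *)
From HB Require Import structures.
From mathcomp Require Import all_boot all_order all_algebra.
From mathcomp Require Import complex mxtens.
From mathcomp Require Import classical_sets reals ereal constructive_ereal exp.

Set Implicit Arguments.
Unset Strict Implicit.
Unset Printing Implicit Defensive.

Import Order.TTheory GRing.Theory Num.Theory.
Local Open Scope ring_scope.

(* Operators on C^n are matrices over R[i], kets are column vectors, and the
   Hilbert space C^a (x) C^b is C^(a * b) with |i>|j> = |mxtens_index (i, j)>,
   that is, |i * b + j>. *)

Definition adjmx (R : realType) (a b : nat) (A : 'M[R[i]]_(a, b)) :
    'M[R[i]]_(b, a) :=
  map_mx (@Num.conj R[i]) A^T.

Definition psd (R : realType) (n : nat) (A : 'M[R[i]]_n) : Prop :=
  forall v : 'cV[R[i]]_n, 0 <= (adjmx v *m A *m v) 0 0.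

Definition density (R : realType) (n : nat) (A : 'M[R[i]]_n) : Prop :=
  psd A /\ \tr A = 1.

Definition ptrace1 (R : realType) (a b : nat) (A : 'M[R[i]]_(a * b)) :
    'M[R[i]]_b :=
  \matrix_(i, j) \sum_(s < a) A (mxtens_index (s, i)) (mxtens_index (s, j)).

Definition ptrace2 (R : realType) (a b : nat) (A : 'M[R[i]]_(a * b)) :
    'M[R[i]]_a :=
  \matrix_(i, j) \sum_(s < b) A (mxtens_index (i, s)) (mxtens_index (j, s)).

Definition purifies (R : realType) (a e : nat) (psi : 'cV[R[i]]_(a * e))
    (rho : 'M[R[i]]_a) : Prop :=
  ptrace2 (psi *m adjmx psi) = rho.

Definition log2 (R : realType) (x : R) : R := ln x / ln 2.

(* 0 log 0 = 0, since ln 0 = 0. *)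
Definition vn_entropy (R : realType) (n : nat) (A : 'M[R[i]]_n) : R :=
  - \sum_(i < n) let p := complex.Re (spectral_diag A 0 i) in p * log2 p.

(* Tr sqrt(A^dagger A) *)
Definition trace_norm (R : realType) (n : nat) (A : 'M[R[i]]_n) : R :=
  \sum_(i < n) Num.sqrt (complex.Re (spectral_diag (adjmx A *m A) 0 i)).

(* A classical-quantum operator \sum_t |t><t| (x) rho_t is represented by the
   family (rho_t) of its blocks; cq_op rebuilds the operator. *)
Definition cqop (R : realType) (T : finType) (e : nat) := T -> 'M[R[i]]_e.

Definition cq_op (R : realType) (T : finType) (e : nat) (rho : cqop R T e) :
    'M[R[i]]_(#|T| * e) :=
  \sum_(t : T) delta_mx (enum_rank t) (enum_rank t) *t rho t.

Definition cq_density (R : realType) (T : finType) (e : nat)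
    (rho : cqop R T e) : Prop :=
  (forall t, psd (rho t)) /\ \sum_(t : T) \tr (rho t) = 1.

(* Classical post-processing t |-> f t; for a projection f this is the partial
   trace over the discarded registers. *)
Definition cq_map (R : realType) (T S : finType) (e : nat) (f : T -> S)
    (rho : cqop R T e) : cqop R S e :=
  fun s => \sum_(t : T | f t == s) rho t.

Definition cq_trace (R : realType) (T : finType) (e : nat)
    (rho : cqop R T e) : cqop R T 1 :=
  fun t => (\tr (rho t))%:M.

(* H(X|Z E) = H(XZE) - H(ZE), where X = f t and Z = g t are functions of the
   classical register and E is the quantum system. *)
Definition cond_entropy (R : realType) (T X Z : finType) (e : nat)
    (rho : cqop R T e) (f : T -> X) (g : T -> Z) : R :=
  vn_entropy (cq_op (cq_map (fun t => (f t, g t)) rho))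
  - vn_entropy (cq_op (cq_map g rho)).

Definition stochastic (R : realType) (T : finType) (p : T -> R) : Prop :=
  (forall t, 0 <= p t) /\ \sum_(t : T) p t = 1.

(* Key distillation from n rounds in which Alice holds X, Bob holds Y and M is
   public, carried out separately on the rounds of each value of M.  For every
   value m, Alice uses local randomness to turn her raw data of the rounds with
   M = m into nbits m key bits and a public message, from which Bob computes his
   key bits.  Raw data are seen through [restrict], hiding all other rounds. *)
Record distillation (R : realType) (X Y M : finType) (n : nat) := Distillation {
  nbits : M -> nat;
  msg : finType;
  alice : forall m : M,
    {ffun 'I_n -> option X} -> (nbits m).-tuple bool * msg -> R;
  bob : forall m : M,
    {ffun 'I_n -> option Y} -> msg -> (nbits m).-tuple bool -> R;
  alice_stochastic : forall m xs, stochastic (@alice m xs);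
  bob_stochastic : forall m ys c, stochastic (@bob m ys c)
}.

Arguments alice {R X Y M n} _ m _ _.
Arguments bob {R X Y M n} _ m _ _ _.

Definition restrict (X M : finType) (n : nat) (m : M)
    (ms : {ffun 'I_n -> M}) (xs : {ffun 'I_n -> X}) :
    {ffun 'I_n -> option X} :=
  [ffun i => if ms i == m then Some (xs i) else None].

Definition keys (R : realType) (X Y M : finType) (n : nat)
    (D : distillation R X Y M n) : finType :=
  {dffun forall m : M, (nbits D m).-tuple bool}.

Definition total_bits (R : realType) (X Y M : finType) (n : nat)
    (D : distillation R X Y M n) : nat :=
  (\sum_(m : M) nbits D m)%N.

(* The tensor product of the F i, the basis of (C^e)^(x n) being indexed by
   functions 'I_n -> 'I_e. *)
Definition tens_family (R : realType) (n e : nat) (F : 'I_n -> 'M[R[i]]_e) :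
    'M[R[i]]_#|{ffun 'I_n -> 'I_e}| :=
  \matrix_(a, b) \prod_(i < n)
    F i ((enum_val a : {ffun 'I_n -> 'I_e}) i)
        ((enum_val b : {ffun 'I_n -> 'I_e}) i).

(* Alice's key, Bob's key, the public messages, the public register, and the n
   copies of the eavesdropper's system, when the rounds are i.i.d. in state
   sigma. *)
Definition final_state (R : realType) (X Y M : finType) (e n : nat)
    (sigma : cqop R (X * Y * M)%type e) (D : distillation R X Y M n) :
    cqop R (keys D * keys D * {ffun M -> msg D} * {ffun 'I_n -> M})%type
      #|{ffun 'I_n -> 'I_e}| :=
  fun o => let: (kA, kB, c, ms) := o in
  \sum_(xs : {ffun 'I_n -> X}) \sum_(ys : {ffun 'I_n -> Y})
    (\prod_(m : M) (alice D m (restrict m ms xs) (kA m, c m)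
                    * bob D m (restrict m ms ys) (c m) (kB m)))%:C%C
    *: tens_family (fun i => sigma (xs i, ys i, ms i)).

(* Identical uniform keys, independent of everything the eavesdropper has. *)
Definition ideal_state (R : realType) (X Y M : finType) (e n : nat)
    (sigma : cqop R (X * Y * M)%type e) (D : distillation R X Y M n) :
    cqop R (keys D * keys D * {ffun M -> msg D} * {ffun 'I_n -> M})%type
      #|{ffun 'I_n -> 'I_e}| :=
  fun o => let: (kA, kB, c, ms) := o in
  if kA == kB then
    (2 ^+ total_bits D)^-1 *:
      \sum_(kA' : keys D) \sum_(kB' : keys D) final_state sigma (kA', kB', c, ms)
  else 0.

Definition secure (R : realType) (X Y M : finType) (e n : nat)
    (sigma : cqop R (X * Y * M)%type e) (D : distillation R X Y M n) (eps : R) :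
    Prop :=
  2^-1 * \sum_o trace_norm (final_state sigma (D := D) o - ideal_state sigma o)
    <= eps.

Definition achievable_rate (R : realType) (X Y M : finType) (e : nat)
    (sigma : cqop R (X * Y * M)%type e) (r : R) : Prop :=
  forall eps delta : R, 0 < eps -> 0 < delta ->
  exists N : nat, forall n : nat, (N <= n)%N ->
  exists D : distillation R X Y M n,
    secure sigma D eps /\ n%:R * (r - delta) <= (total_bits D)%:R.

Definition key_rate (R : realType) (X Y M : finType) (e : nat)
    (sigma : cqop R (X * Y * M)%type e) : \bar R :=
  ereal_sup (EFin @` [set r : R | achievable_rate sigma r]).

(* The Devetak-Winter bound under collective attacks, where the eavesdropper
   holds E and the public register M, which Alice and Bob know too. *)
Definition devetak_winter_bound (R : realType) : Prop :=
  forall (X Y M : finType) (e : nat) (sigma : cqop R (X * Y * M)%type e),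
  cq_density sigma ->
  ((cond_entropy sigma (fun t => t.1.1) (fun t => t.2)
    - cond_entropy (cq_trace sigma) (fun t => t.1.1) (fun t => (t.1.2, t.2)))%:E
   <= key_rate sigma)%E.

Definition basis_proj (R : realType) (d : nat) (x : 'I_d) : 'M[R[i]]_d :=
  delta_mx x x.

(* Alice and Bob measure in the computational basis and record f x y; Eve's
   system is left untouched. *)
Definition measure_record (R : realType) (d e : nat) (T : finType)
    (f : 'I_d -> 'I_d -> T) (rho : 'M[R[i]]_(d * d * e)) : cqop R T e :=
  fun t => \sum_(x < d) \sum_(y < d | f x y == t)
    let P := basis_proj R x *t basis_proj R y *t (1%:M : 'M[R[i]]_e) in
    ptrace1 (P *m rho *m adjmx P).

(* An outcome x = m * k + i is mxtens_index (m, i). *)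
Definition subspace (l k : nat) (x : 'I_(l * k)) : 'I_l := (mxtens_unindex x).1.
Definition offset (l k : nat) (x : 'I_(l * k)) : 'I_k := (mxtens_unindex x).2.

(* (X', Y', M) after sifting and subspace selection; None stands for the
   discard symbol. *)
Definition sift (l k : nat) (x y : 'I_(l * k)) :
    option 'I_k * option 'I_k * option 'I_l :=
  if subspace x == subspace y
  then (Some (offset x), Some (offset y), Some (subspace x))
  else (None, None, None).

Definition round_state (R : realType) (l k e : nat)
    (psi : 'cV[R[i]]_(l * k * (l * k) * e)) :
    cqop R (option 'I_k * option 'I_k * option 'I_l)%type e :=
  measure_record (@sift l k) (psi *m adjmx psi).

(* Key bits per round: test rounds have vanishing frequency and are not
   counted. *)
Definition protocol_key_rate (R : realType) (l k e : nat)
    (psi : 'cV[R[i]]_(l * k * (l * k) * e)) : \bar R :=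
  key_rate (round_state psi).

Definition subspace_proj (R : realType) (l k : nat) (m : 'I_l) :
    'M[R[i]]_(l * k) :=
  \sum_(i < k) basis_proj R (mxtens_index (m, i)).

Definition subspace_proj2 (R : realType) (l k : nat) (m : 'I_l) :
    'M[R[i]]_(l * k * (l * k)) :=
  subspace_proj R k m *t subspace_proj R k m.

Definition subspace_prob (R : realType) (l k : nat)
    (rho : 'M[R[i]]_(l * k * (l * k))) (m : 'I_l) : R :=
  complex.Re (\tr (subspace_proj2 R k m *m rho)).

Definition subspace_state (R : realType) (l k : nat)
    (rho : 'M[R[i]]_(l * k * (l * k))) (m : 'I_l) :
    'M[R[i]]_(l * k * (l * k)) :=
  ((subspace_prob rho m)^-1)%:C%C *:
    (subspace_proj2 R k m *m rho *m subspace_proj2 R k m).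

Definition keygen_state (R : realType) (l k e : nat)
    (psi : 'cV[R[i]]_(l * k * (l * k) * e)) : cqop R ('I_k * 'I_k)%type e :=
  measure_record (fun x y => (offset x, offset y)) (psi *m adjmx psi).

(* H(X'|E) - H(X'|Y') *)
Definition subspace_rate (R : realType) (k e : nat)
    (rho : cqop R ('I_k * 'I_k)%type e) : R :=
  cond_entropy rho (fun t => t.1) (fun=> tt)
  - cond_entropy (cq_trace rho) (fun t => t.1) (fun t => t.2).

(* Main.v *)
(* Each conditional entropy in the Devetak-Winter bound is a difference of sums,
   over the values of a classical register, of entropies of Eve's unnormalized
   conditional states.  The discarded rounds contribute the same term to both
   sums, since X' is constant on them.  The remaining terms split according to m.
   Writing a purification as a matrix A, Eve's state A A^dagger has the same
   nonzero spectrum as A^dagger A, which is determined by the block of rho_AB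
   singled out by the outcomes; on the m-th subspace this block is p(m) times the
   one of rho^m_AB.  Hence the entropies scale by p(m) up to a correction
   p(m) log p(m), which cancels in each conditional entropy. *)

Require Import Defs.
From mathcomp Require Import all_boot all_order all_algebra.
From mathcomp Require Import complex mxtens ring.
From mathcomp Require Import classical_sets reals ereal constructive_ereal exp.

Set Implicit Arguments.
Unset Strict Implicit.
Unset Printing Implicit Defensive.

Import Order.TTheory GRing.Theory Num.Theory.
Local Open Scope ring_scope.

(** * Sums over tensor indices, and characteristic polynomials *)

Lemma sum_mxtens (V : nmodType) (a b : nat) (F : 'I_(a * b) -> V) :
  \sum_q F q = \sum_(i < a) \sum_(j < b) F (mxtens_index (i, j)).
Proof.
rewrite (reindex (@mxtens_index a b)) /=; last first.
  by exists (@mxtens_unindex a b) => q _; rewrite (mxtens_indexK, mxtens_unindexK).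
by rewrite pair_bigA; apply: eq_bigr => -[].
Qed.

Lemma char_poly_similar (F : fieldType) (n : nat) (P A : 'M[F]_n) :
  P \in unitmx -> char_poly (invmx P *m A *m P) = char_poly A.
Proof.
move=> uP; pose p := map_mx polyC P; pose q := map_mx polyC (invmx P).
have qp : q *m p = 1%:M by rewrite -map_mxM mulVmx // map_mx1.
rewrite /char_poly.
(* The similarity lifts to polynomial matrices: the scalar matrix ['X%:M] commutes with [p], hence
   is fixed by the conjugation. *)
have -> : char_poly_mx (invmx P *m A *m P) = q *m char_poly_mx A *m p.
  rewrite /char_poly_mx !map_mxM /= mulmxBr mulmxBl -/p -/q; congr (_ - _).
  by rewrite scalar_mxC -mulmxA qp mulmx1.
by rewrite !det_mulmx mulrAC -det_mulmx qp det1 mul1r.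
Qed.

(* Both sides come from the Schur complements of the block matrix
   ['X A; B 1]. *)
Lemma char_poly_mulmxC (F : comNzRingType) (m n : nat)
    (A : 'M[F]_(m, n)) (B : 'M[F]_(n, m)) :
  'X^n * char_poly (A *m B) = 'X^m * char_poly (B *m A).
Proof.
pose a := map_mx polyC A; pose b := map_mx polyC B.
pose M : 'M[{poly F}]_(m + n) := block_mx 'X%:M a b 1%:M.
have detM : \det M = char_poly (A *m B).
  have : M *m block_mx 1%:M 0 (- b) 1%:M = block_mx (char_poly_mx (A *m B)) a 0 1%:M.
    rewrite mulmx_block !mulmx1 !mulmx0 !mul1mx add0r mulmxN subrr add0r.
    by rewrite /char_poly_mx map_mxM.
  move/(congr1 determinant); rewrite det_mulmx det_lblock det_ublock.
  by rewrite !det1 !mulr1.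
have : block_mx 1%:M 0 (- b) 'X%:M *m M = block_mx 'X%:M a 0 (char_poly_mx (B *m A)).
  rewrite mulmx_block !mulmx1 !mul0mx !mul1mx !addr0 !mulNmx.
  by rewrite scalar_mxC addNr addrC /char_poly_mx map_mxM.
move/(congr1 determinant); rewrite det_mulmx det_lblock det_ublock.
by rewrite det1 mul1r !det_scalar detM.
Qed.

(** * Adjoints, and the entropy as a function of the characteristic polynomial *)

Lemma adjmxE (R : realType) (a b : nat) (A : 'M[R[i]]_(a, b)) i j :
  adjmx A i j = Num.conj (A j i).
Proof. by rewrite !mxE. Qed.

Lemma adjmxK (R : realType) (a b : nat) (A : 'M[R[i]]_(a, b)) :
  adjmx (adjmx A) = A.
Proof. by apply/matrixP => i j; rewrite !adjmxE conjCK. Qed.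

Lemma adjmxM (R : realType) (a b c : nat) (A : 'M[R[i]]_(a, b))
    (B : 'M[R[i]]_(b, c)) : adjmx (A *m B) = adjmx B *m adjmx A.
Proof. by rewrite /adjmx trmx_mul map_mxM. Qed.

Lemma normal_selfadjoint (R : realType) (n : nat) (A : 'M[R[i]]_n) :
  adjmx A = A -> A \is normalmx.
Proof. by rewrite /adjmx => hA; apply/normalmxP; rewrite hA. Qed.

Definition entropy_term (R : realType) (z : R[i]) : R :=
  complex.Re z * log2 (complex.Re z).

Lemma entropy_term0 (R : realType) : entropy_term (0 : R[i]) = 0.
Proof. by rewrite /entropy_term /= mul0r. Qed.

Lemma char_poly_diag (R : comNzRingType) (n : nat) (d : 'rV[R]_n) :
  char_poly (diag_mx d) = \prod_(z <- [seq d 0 i | i : 'I_n]) ('X - z%:P).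
Proof.
rewrite char_poly_trig ?diag_mx_is_trig // big_image /=.
by apply: eq_bigr => i _; rewrite mxE eqxx.
Qed.

Lemma char_poly_spectral (R : realType) (n : nat) (A : 'M[R[i]]_n) :
  adjmx A = A ->
  char_poly A = \prod_(z <- [seq spectral_diag A 0 i | i : 'I_n]) ('X - z%:P).
Proof.
move=> /normal_selfadjoint /orthomx_spectralP eA.
by rewrite [in LHS]eA char_poly_similar ?spectral_unit // char_poly_diag.
Qed.

(** A product of linear factors determines its roots up to order, and the entropy is a symmetric
    function of the eigenvalues. Spectra can thus be compared without knowing how [spectral_diag]
    orders them. *)
Lemma vn_entropy_char_poly (R : realType) (n : nat) (A : 'M[R[i]]_n)
    (s : seq R[i]) :
  adjmx A = A -> char_poly A = \prod_(z <- s) ('X - z%:P) ->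
  vn_entropy A = - \sum_(z <- s) entropy_term z.
Proof.
move=> /char_poly_spectral -> /prod_XsubC_eq pe; congr (- _).
by rewrite -(perm_big _ pe) /= big_image.
Qed.

Lemma vn_entropy_diagonalized (R : realType) (n : nat) (A P : 'M[R[i]]_n)
    (d : 'rV[R[i]]_n) :
  adjmx A = A -> P \in unitmx -> A = invmx P *m diag_mx d *m P ->
  vn_entropy A = - \sum_i entropy_term (d 0 i).
Proof.
move=> hA uP eA; rewrite (@vn_entropy_char_poly _ _ _ [seq d 0 i | i : 'I_n]) //.
  by rewrite big_image.
by rewrite eA char_poly_similar // char_poly_diag.
Qed.

(** By [char_poly_mulmxC] the two spectra agree once padded with zeros, and a zero eigenvalue
    contributes nothing to the entropy. *)
Lemma vn_entropy_gramC (R : realType) (m n : nat) (A : 'M[R[i]]_(m, n)) :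
  vn_entropy (A *m adjmx A) = vn_entropy (adjmx A *m A).
Proof.
have h1 : adjmx (A *m adjmx A) = A *m adjmx A by rewrite adjmxM adjmxK.
have h2 : adjmx (adjmx A *m A) = adjmx A *m A by rewrite adjmxM adjmxK.
have := char_poly_mulmxC A (adjmx A).
rewrite (char_poly_spectral h1) (char_poly_spectral h2).
(* The powers of ['X] become products over zero roots, so that both sides are products of linear
   factors. *)
have X0 k : 'X^k = \prod_(z <- nseq k (0 : R[i])) ('X - z%:P).
  by rewrite big_nseq subr0 iter_mulr_1.
rewrite !X0 -!big_cat => /prod_XsubC_eq pe; congr (- _).
have := perm_big (op := +%R) (x := 0) (P := xpredT) (F := @entropy_term R) _ pe.
have S0 k : \sum_(z <- nseq k (0 : R[i])) entropy_term z = 0.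
  by rewrite big_nseq entropy_term0 iter_addr_0 mul0rn.
by rewrite !big_cat /= !S0 !add0r !big_image.
Qed.

(** * Classical-quantum operators as block-diagonal matrices *)

Lemma cq_opE (R : realType) (T : finType) (e : nat) (rho : cqop R T e) a b i j :
  cq_op rho (mxtens_index (a, i)) (mxtens_index (b, j))
  = (rho (enum_val a) i j) *+ (a == b).
Proof.
rewrite /cq_op summxE (bigD1 (enum_val a)) //= big1 => [|t ne].
  rewrite tensmxE mxE enum_valK eqxx /= addr0 eq_sym.
  by rewrite mulr_natl.
rewrite tensmxE mxE; case: eqP => [ea|]; last by rewrite mul0r.
by rewrite ea enum_rankK eqxx in ne.
Qed.

Lemma cq_opM (R : realType) (T : finType) (e : nat) (rho tau : cqop R T e) :
  cq_op rho *m cq_op tau = cq_op (fun t => rho t *m tau t).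
Proof.
apply/matrixP => q r; case: (mxtens_indexP q) => a i; case: (mxtens_indexP r) => b j.
rewrite mxE sum_mxtens cq_opE (bigD1 a) //= [X in _ + X]big1 ?addr0 => [|c ne].
  rewrite mxE -sumrMnl; apply: eq_bigr => c _.
  by rewrite !cq_opE eqxx mulr1n mulrnAr.
by apply: big1 => d _; rewrite cq_opE eq_sym (negbTE ne) mul0r.
Qed.

Lemma cq_op1 (R : realType) (T : finType) (e : nat) :
  cq_op (fun=> 1%:M : 'M[R[i]]_e) = 1%:M :> 'M_(#|T| * e).
Proof.
apply/matrixP => q r; case: (mxtens_indexP q) => a i; case: (mxtens_indexP r) => b j.
rewrite cq_opE !mxE (can_eq (@mxtens_indexK _ _)) xpair_eqE andbC.
by case: (a == b); rewrite ?andbF // andbT.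
Qed.

(** The spectral bases of the blocks assemble into a basis diagonalizing the whole operator, whose
    spectrum is the union of theirs. The blocks are unnormalized, so no separate Shannon term
    appears. *)
Lemma vn_entropy_cq_op (R : realType) (T : finType) (e : nat) (rho : cqop R T e) :
  (forall t, adjmx (rho t) = rho t) ->
  vn_entropy (cq_op rho) = \sum_t vn_entropy (rho t).
Proof.
move=> hrho.
have h : adjmx (cq_op rho) = cq_op rho.
  apply/matrixP => q r; case: (mxtens_indexP q) => a i.
  case: (mxtens_indexP r) => b j; rewrite adjmxE !cq_opE rmorphMn /= -adjmxE hrho.
  by rewrite eq_sym; case: eqP => [->|].
pose V := cq_op (fun t => spectralmx (rho t)).
pose W := cq_op (fun t => invmx (spectralmx (rho t))).
have WV : W *m V = 1%:M.
  rewrite cq_opM -cq_op1; congr cq_op; apply: boolp.funext => t.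
  by rewrite mulVmx ?spectral_unit.
have uV : V \in unitmx by case/mulmx1_unit: WV.
have eW : W = invmx V by rewrite -[W]mulmx1 -(mulmxV uV) mulmxA WV mul1mx.
(* The eigenvalue at the index [(a, j)] is the [j]-th one of block [a]. *)
pose d : 'rV_(#|T| * e) := \row_q
  spectral_diag (rho (enum_val (mxtens_unindex q).1)) 0 (mxtens_unindex q).2.
rewrite (@vn_entropy_diagonalized _ _ _ V d) //; last first.
  have -> : diag_mx d = cq_op (fun t => diag_mx (spectral_diag (rho t))).
    apply/matrixP => q r; case: (mxtens_indexP q) => a i.
    case: (mxtens_indexP r) => b j.
    rewrite cq_opE !mxE (can_eq (@mxtens_indexK _ _)) mxtens_indexK xpair_eqE /=.
    by case: (a == b); rewrite ?mulr1n.
  rewrite -eW !cq_opM; congr cq_op; apply: boolp.funext => t.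
  by apply/orthomx_spectralP/normal_selfadjoint.
rewrite sum_mxtens -sumrN [RHS](reindex (@enum_val T T)) /=; last first.
  exact/onW_bij/enum_val_bij.
apply: eq_bigr => a _; congr (- _); apply: eq_bigr => j _.
by rewrite mxE mxtens_indexK.
Qed.

(** * Behaviour of the entropy under scaling *)

Lemma Re_sum (R : realType) (I : Type) (r : seq I) (P : pred I) (F : I -> R[i]) :
  complex.Re (\sum_(i <- r | P i) F i) = \sum_(i <- r | P i) complex.Re (F i).
Proof. by apply: big_morph => // -[? ?] [? ?]. Qed.

Lemma Re_scale (R : realType) (c : R) (z : R[i]) :
  complex.Re (c%:C%C * z) = c * complex.Re z.
Proof. by case: z => a b /=; rewrite mul0r subr0. Qed.

Lemma conj_real (R : realType) (c : R) : Num.conj (c%:C%C : R[i]) = c%:C%C.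
Proof. by apply: conj_Creal; rewrite complex_real. Qed.

Lemma entropy_term_scale (R : realType) (c : R) (z : R[i]) :
  0 < c -> 0 <= complex.Re z ->
  entropy_term (c%:C%C * z) = c * entropy_term z + c * log2 c * complex.Re z.
Proof.
(* The logarithm of a product splits only for positive factors; when the real part of [z] is zero,
   every term has a zero factor. *)
move=> c0; rewrite /entropy_term Re_scale le_eqVlt => /predU1P[<-|z0].
  by rewrite !(mul0r, mulr0) addr0.
by rewrite /log2 lnM ?posrE // mulrDl; ring.
Qed.

Lemma spectral_diag_ge0 (R : realType) (n : nat) (A : 'M[R[i]]_n) i :
  psd A -> adjmx A = A -> 0 <= complex.Re (spectral_diag A 0 i).
Proof.
move=> psdA /normal_selfadjoint /orthomx_spectralP eA.
set P := spectralmx A in eA.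
have uP : P \is unitarymx by apply: spectral_unitarymx.
have eD : diag_mx (spectral_diag A) = P *m A *m adjmx P.
  rewrite [A in RHS]eA invmx_unitary // /adjmx !mulmxA.
  by rewrite (unitarymxP uP) mul1mx -mulmxA (unitarymxP uP) mulmx1.
(* The adjoint of row [i] of the unitary [P] is an eigenvector, and the quadratic form of [A] there
   is the [i]-th eigenvalue. *)
have := psdA (adjmx (row i P)); rewrite adjmxK.
have -> : (row i P *m A *m adjmx (row i P)) 0 0 = spectral_diag A 0 i.
  have -> : row i P *m A *m adjmx (row i P) = row i (P *m A) *m adjmx (row i P).
    by rewrite row_mul.
  transitivity ((P *m A *m adjmx P) i i); last by rewrite -eD mxE eqxx mulr1n.
  by rewrite !mxE; apply: eq_bigr => j _; rewrite !mxE.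
by rewrite lecE => /andP[].
Qed.

(** Scaling each eigenvalue adds a correction linear in it; the eigenvalues sum to the trace, hence
    the last term. *)
Lemma vn_entropy_scale (R : realType) (n : nat) (c : R) (A : 'M[R[i]]_n) :
  0 < c -> psd A -> adjmx A = A ->
  vn_entropy (c%:C%C *: A)
  = c * vn_entropy A - c * log2 c * complex.Re (\tr A).
Proof.
move=> c0 psdA hA; have eA := orthomx_spectralP (normal_selfadjoint hA).
have trA : \tr A = \sum_i spectral_diag A 0 i.
  by rewrite [in LHS]eA mxtrace_mulC mulmxA mulmxV ?spectral_unit // mul1mx mxtrace_diag.
rewrite (@vn_entropy_diagonalized _ _ _ (spectralmx A) (c%:C%C *: spectral_diag A)).
- rewrite trA Re_sum /vn_entropy mulrN -opprD !mulr_sumr -big_split; congr (- _).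
  by apply: eq_bigr => i _; rewrite mxE entropy_term_scale ?spectral_diag_ge0.
- by apply/matrixP => i j; rewrite adjmxE !mxE rmorphM /= conj_real -adjmxE hA.
- exact: spectral_unit.
by rewrite linearZ -scalemxAr -scalemxAl [in LHS]eA.
Qed.

Lemma vn_entropy0 (R : realType) (n : nat) : vn_entropy (0 : 'M[R[i]]_n) = 0.
Proof.
rewrite (@vn_entropy_diagonalized _ _ _ 1%:M 0) ?unitmx1 //.
- by rewrite big1 ?oppr0 // => i _; rewrite mxE entropy_term0.
- by apply/matrixP => i j; rewrite adjmxE !mxE rmorph0.
by rewrite mulmx1 invmx1 mul1mx linear0.
Qed.

(** * Gram matrices and Eve's unnormalized conditional states *)

Lemma gram_selfadjoint (R : realType) (m n : nat) (A : 'M[R[i]]_(m, n)) :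
  adjmx (A *m adjmx A) = A *m adjmx A.
Proof. by rewrite adjmxM adjmxK. Qed.

Lemma gram_psd (R : realType) (m n : nat) (A : 'M[R[i]]_(m, n)) :
  psd (A *m adjmx A).
Proof.
move=> v; rewrite mulmxA -mulmxA -{1}[A]adjmxK -adjmxM mxE.
by apply: sumr_ge0 => j _; rewrite adjmxE mulrC -normCK exprn_ge0.
Qed.

Section EveState.
Variables (R : realType) (a e : nat).
Implicit Types (psi : 'cV[R[i]]_(a * e)) (rho : 'M[R[i]]_a) (Z : pred 'I_a).

(** The pure state written as a matrix from the measured system to Eve's. Columns outside [Z] are
    zeroed rather than removed, so that the size does not depend on [Z]. *)
Definition amplitudes psi Z : 'M[R[i]]_(e, a) :=
  \matrix_(i, z) if Z z then psi (mxtens_index (z, i)) 0 else 0.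

(* Eve's unnormalized state when the pure state [psi] is measured in the
   computational basis of the first factor with outcome in [Z]. *)
Definition eve_state psi Z : 'M[R[i]]_e :=
  amplitudes psi Z *m adjmx (amplitudes psi Z).

Lemma eve_stateE psi Z i j : eve_state psi Z i j =
  \sum_(z | Z z) psi (mxtens_index (z, i)) 0 * Num.conj (psi (mxtens_index (z, j)) 0).
Proof.
rewrite mxE [RHS]big_mkcond /=; apply: eq_bigr => z _.
by rewrite adjmxE !mxE; case: (Z z); rewrite ?mul0r.
Qed.

Lemma mxtrace_eve_state_ge0 psi Z : 0 <= \tr (eve_state psi Z).
Proof.
rewrite /mxtrace; apply: sumr_ge0 => i _; rewrite eve_stateE.
by apply: sumr_ge0 => z _; rewrite -normCK exprn_ge0.
Qed.

Lemma eq_eve_state psi Z Z' : Z =1 Z' -> eve_state psi Z = eve_state psi Z'.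
Proof. by move=> eZ; apply/matrixP => i j; rewrite !eve_stateE; apply: eq_bigl. Qed.

Lemma eve_state_pred0 psi : eve_state psi xpred0 = 0.
Proof. by apply/matrixP => i j; rewrite eve_stateE big_pred0 ?mxE. Qed.

(** Coarse-graining of outcomes: after exchanging the sums, each [z] is counted once, at [t = h z].
    With a constant [g] it sums over all outcomes. *)
Lemma eve_state_partition (T S : finType) psi (h : 'I_a -> T) (g : T -> S) s :
  \sum_(t | g t == s) eve_state psi [pred z | h z == t]
  = eve_state psi [pred z | g (h z) == s].
Proof.
apply/matrixP => i j; rewrite summxE eve_stateE /=.
under eq_bigr do rewrite eve_stateE /=.
rewrite (exchange_big_dep (fun z => g (h z) == s)) /= => [|t z /eqP<- /eqP-> //].
apply: eq_bigr => z /eqP gh; rewrite (big_pred1 (h z)) // => t /=.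
by rewrite [h z == t]eq_sym; case: (t =P h z) => [->|]; rewrite ?andbF // gh eqxx.
Qed.

Lemma purifiesE psi rho z w : purifies psi rho ->
  rho z w = \sum_i psi (mxtens_index (z, i)) 0 * Num.conj (psi (mxtens_index (w, i)) 0).
Proof.
move=> <-; rewrite mxE; apply: eq_bigr => i _.
by rewrite mxE big_ord1 adjmxE.
Qed.

Lemma mxtrace_eve_state psi rho Z : purifies psi rho ->
  \tr (eve_state psi Z) = \sum_(z | Z z) rho z z.
Proof.
move=> hpsi; rewrite /mxtrace; under eq_bigr do rewrite eve_stateE.
by rewrite exchange_big /=; apply: eq_bigr => z _; rewrite (purifiesE _ _ hpsi).
Qed.

Lemma purifies_diag_ge0 psi rho z : purifies psi rho -> 0 <= rho z z.
Proof.
move=> hpsi; rewrite (purifiesE _ _ hpsi); apply: sumr_ge0 => i _.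
by rewrite -normCK exprn_ge0.
Qed.

(** The diagonal entry at [z] is the sum of the squared moduli of the amplitudes at [z]. *)
Lemma purifies_diag0 psi rho z i : purifies psi rho -> rho z z = 0 ->
  psi (mxtens_index (z, i)) 0 = 0.
Proof.
move=> hpsi /eqP; rewrite (purifiesE _ _ hpsi) psumr_eq0 => [|j _].
  by move/allP/(_ i (mem_index_enum _)); rewrite -normCK expf_eq0 normr_eq0 /= => /eqP.
by rewrite -normCK exprn_ge0.
Qed.

(** The conjugate falls on the left factor here and on the right one in the partial trace, whence
    the transposed entry [rho w z]. *)
Lemma amplitudes_gram psi rho Z : purifies psi rho ->
  adjmx (amplitudes psi Z) *m amplitudes psi Z
  = \matrix_(z, w) if Z z && Z w then rho w z else 0.
Proof.
move=> hpsi; apply/matrixP => z w.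
rewrite !mxE; case Zz: (Z z); case Zw: (Z w) => /=.
- rewrite (purifiesE _ _ hpsi); apply: eq_bigr => i _.
  by rewrite adjmxE !mxE Zz Zw mulrC.
- by rewrite big1 // => i _; rewrite !mxE Zw mulr0.
- by rewrite big1 // => i _; rewrite adjmxE !mxE Zz rmorph0 mul0r.
by rewrite big1 // => i _; rewrite !mxE Zw mulr0.
Qed.

End EveState.

(* [A A^dagger] and [A^dagger A] have the same entropy, and the latter is, up to
   transposition, the block [Z] of the purified state: Eve's entropy does
   not depend on the purification. *)
Lemma vn_entropy_eve_state_scale (R : realType) (a e : nat)
    (psi psi' : 'cV[R[i]]_(a * e)) (rho rho' : 'M[R[i]]_a) (c : R) (Z : pred 'I_a) :
  0 < c -> purifies psi rho -> purifies psi' rho' ->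
  (forall z w, Z z -> Z w -> rho z w = c%:C%C * rho' z w) ->
  vn_entropy (eve_state psi Z) = c * vn_entropy (eve_state psi' Z)
    - c * log2 c * complex.Re (\tr (eve_state psi' Z)).
Proof.
move=> c0 hpsi hpsi' erho.
(* Entropies and trace all pass to the other Gram matrix, where proportionality of the blocks of
   [rho] and [rho'] can be used. *)
rewrite /eve_state !vn_entropy_gramC mxtrace_mulC -(vn_entropy_scale c0).
- rewrite !(amplitudes_gram _ hpsi, amplitudes_gram _ hpsi').
  congr vn_entropy; apply/matrixP => z w; rewrite !mxE.
  by case Zz: (Z z); case Zw: (Z w) => /=; rewrite ?mulr0 // erho.
- by rewrite -[X in _ *m X]adjmxK; apply: gram_psd.
by rewrite adjmxM adjmxK.
Qed.

(** * Measurement records and their conditional entropies *)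

Lemma measure_recordE (R : realType) (d e : nat) (T : finType)
    (f : 'I_d -> 'I_d -> T) (psi : 'cV[R[i]]_(d * d * e)) t :
  measure_record f (psi *m adjmx psi) t
  = eve_state psi [pred z | f (mxtens_unindex z).1 (mxtens_unindex z).2 == t].
Proof.
apply/matrixP => i j; rewrite eve_stateE big_mkcond sum_mxtens summxE.
apply: eq_bigr => x _; rewrite summxE big_mkcond; apply: eq_bigr => y _.
rewrite [in RHS]inE mxtens_indexK; case: ifP => // _.
set P := basis_proj R x *t basis_proj R y *t (1%:M : 'M[R[i]]_e).
(* The projector keeps the amplitudes at the outcome pair [(x, y)] and kills all others; the partial
   trace then has a single nonzero summand. *)
have Ppsi z k : (P *m psi) (mxtens_index (z, k)) 0 =
    if z == mxtens_index (x, y) then psi (mxtens_index (z, k)) 0 else 0.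
  rewrite mxE sum_mxtens (bigD1 z) //= [X in _ + X]big1 ?addr0 => [|w nwz].
    rewrite (bigD1 k) //= [X in _ + X]big1 ?addr0 => [|k' nk].
      case: (mxtens_indexP z) => x' y'; rewrite !tensmxE !mxE !eqxx !andbb mulr1.
      rewrite (can_eq (@mxtens_indexK _ _)) xpair_eqE -natrM mulnb.
      by case: ifP => _; rewrite ?mul1r ?mul0r.
    by rewrite tensmxE [1%:M _ _]mxE eq_sym (negbTE nk) mulr0 mul0r.
  apply: big1 => k' _; case: (mxtens_indexP z) nwz => x' y'.
  case: (mxtens_indexP w) => x'' y''; rewrite (can_eq (@mxtens_indexK _ _)) => nwz.
  rewrite !tensmxE !mxE -natrM mulnb.
  case: andP => [[/andP[/eqP ex /eqP ex'] /andP[/eqP ey /eqP ey']]|]; last by rewrite !mul0r.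
  by rewrite ex' ey' ex ey eqxx in nwz.
rewrite /=.
have -> : P *m (psi *m adjmx psi) *m adjmx P = (P *m psi) *m adjmx (P *m psi).
  by rewrite adjmxM !mulmxA.
rewrite mxE (bigD1 (mxtens_index (x, y))) //= [X in _ + X]big1 ?addr0 => [|z nz].
  by rewrite mxE big_ord1 adjmxE !Ppsi eqxx.
by rewrite mxE big_ord1 !Ppsi (negbTE nz) mul0r.
Qed.

(** This is [- p log2 p] for the probability [p] of the event [Z]; the 1 by 1 matrix matches the
    blocks of [cq_trace]. *)
Definition outcome_entropy (R : realType) (a e : nat) (psi : 'cV[R[i]]_(a * e))
    (Z : pred 'I_a) : R :=
  vn_entropy ((\tr (eve_state psi Z))%:M : 'M_1).

Lemma outcome_entropy0 (R : realType) (a e : nat) (psi : 'cV[R[i]]_(a * e))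
    (Z : pred 'I_a) : eve_state psi Z = 0 -> outcome_entropy psi Z = 0.
Proof.
move=> eve0; rewrite /outcome_entropy eve0 mxtrace0.
by rewrite (raddf0 (@scalar_mx _ 1)) vn_entropy0.
Qed.

Section CondEntropy.
Variables (R : realType) (a e : nat) (T X Y : finType).
Variables (psi : 'cV[R[i]]_(a * e)) (rho : cqop R T e) (h : 'I_a -> T).
Hypothesis rhoE : forall t, rho t = eve_state psi [pred z | h z == t].

Lemma cq_map_eve_state (S : finType) (f : T -> S) s :
  cq_map f rho s = eve_state psi [pred z | f (h z) == s].
Proof. by rewrite /cq_map -eve_state_partition; apply: eq_bigr => t _. Qed.

Lemma cq_map_trace_eve_state (S : finType) (f : T -> S) s :
  cq_map f (cq_trace rho) s = (\tr (eve_state psi [pred z | f (h z) == s]))%:M.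
Proof.
rewrite -cq_map_eve_state /cq_map /cq_trace.
have -> : \tr (\sum_(t | f t == s) rho t) = \sum_(t | f t == s) \tr (rho t).
  exact: raddf_sum.
by rewrite (raddf_sum (@scalar_mx _ 1)).
Qed.

(** Both entropies are of block-diagonal operators, whose blocks are Eve's states given the value of
    the classical register. *)
Lemma cond_entropy_eve_state (f : T -> X) (g : T -> Y) :
  cond_entropy rho f g =
    \sum_s vn_entropy (eve_state psi [pred z | (f (h z), g (h z)) == s])
    - \sum_s vn_entropy (eve_state psi [pred z | g (h z) == s]).
Proof.
rewrite /cond_entropy !vn_entropy_cq_op; first 1 last.
- by move=> t; rewrite cq_map_eve_state; apply: gram_selfadjoint.
- by move=> t; rewrite cq_map_eve_state; apply: gram_selfadjoint.
by congr (_ - _); apply: eq_bigr => s _; rewrite cq_map_eve_state.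
Qed.

Lemma cond_entropy_outcome (f : T -> X) (g : T -> Y) :
  cond_entropy (cq_trace rho) f g =
    \sum_s outcome_entropy psi [pred z | (f (h z), g (h z)) == s]
    - \sum_s outcome_entropy psi [pred z | g (h z) == s].
Proof.
have adj1 Z : adjmx ((\tr (eve_state psi Z))%:M : 'M_1) = (\tr (eve_state psi Z))%:M.
  apply/matrixP => i j; rewrite adjmxE !mxE !ord1 eqxx !mulr1n.
  exact: conj_Creal (ger0_real (mxtrace_eve_state_ge0 _ _)).
rewrite /cond_entropy !vn_entropy_cq_op; first 1 last.
- by move=> t; rewrite cq_map_trace_eve_state adj1.
- by move=> t; rewrite cq_map_trace_eve_state adj1.
by congr (_ - _); apply: eq_bigr => s _; rewrite cq_map_trace_eve_state.
Qed.

End CondEntropy.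

(** A nonnegative trace is a positive 1 by 1 matrix, so this is an instance of
    [vn_entropy_scale]. *)
Lemma outcome_entropy_scale (R : realType) (a e : nat)
    (psi psi' : 'cV[R[i]]_(a * e)) (c : R) (Z Z' : pred 'I_a) :
  0 < c -> \tr (eve_state psi Z) = c%:C%C * \tr (eve_state psi' Z') ->
  outcome_entropy psi Z = c * outcome_entropy psi' Z'
    - c * log2 c * complex.Re (\tr (eve_state psi' Z')).
Proof.
move=> c0 etr; set tr' := \tr (eve_state psi' Z') in etr *.
have tr'_ge0 : 0 <= tr' by apply: mxtrace_eve_state_ge0.
have -> : complex.Re tr' = complex.Re (\tr (tr'%:M : 'M_1)) by rewrite mxtrace_scalar.
rewrite -vn_entropy_scale //.
- by rewrite /outcome_entropy etr scale_scalar_mx.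
- move=> v; rewrite mul_mx_scalar -scalemxAl.
  by rewrite !mxE big_ord1 adjmxE mulr_ge0 // mulrC -normCK exprn_ge0.
by apply/matrixP => i j; rewrite adjmxE !mxE !ord1 eqxx mulr1n (conj_Creal (ger0_real _)).
Qed.

(** * Sums over the values of a classical register *)

Lemma sum_relabel (V : zmodType) (Q S T : finType) (Phi : pred Q -> V)
    (j : S -> T) (h : Q -> S) :
  injective j -> Phi xpred0 = 0 -> (forall Z Z', Z =1 Z' -> Phi Z = Phi Z') ->
  \sum_t Phi [pred z | j (h z) == t] = \sum_s Phi [pred z | h z == s].
Proof.
move=> inj_j Phi0 eqPhi; rewrite (bigID (fun t => t \in j @: setT)) /=.
rewrite [X in _ + X]big1 ?addr0 => [|t nt].
  rewrite big_imset /=; last by move=> ? ? _ _ /inj_j.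
  apply: eq_big => [s|s _]; first by rewrite in_setT.
  by apply: eqPhi => z /=; rewrite (inj_eq inj_j).
(* A value outside the image of [j] labels the empty event, where [Phi] vanishes. *)
rewrite -Phi0; apply: eqPhi => z /=; apply: contraNF nt => /eqP <-.
by rewrite imset_f ?in_setT.
Qed.

Lemma sum_option (V : nmodType) (S : finType) (F : option S -> V) :
  \sum_o F o = F None + \sum_s F (Some s).
Proof.
rewrite (bigD1 None) //=; congr (_ + _).
rewrite (reindex_omap Some id) /=; last by case.
by apply: eq_bigl => s; rewrite eqxx.
Qed.

(** Here [j] encodes either a discarded round or a subspace with a label in it. Register values that
    never occur contribute nothing, so the sum splits into the discard term and one sum per
    subspace. *)
Lemma sum_labels (V : zmodType) (Q M A T : finType) (Phi : pred Q -> V)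
    (u : Q -> option M) (v : Q -> A) (j : option (M * A) -> T) (g : Q -> T) :
  injective j -> (forall z, g z = j (omap (fun m => (m, v z)) (u z))) ->
  Phi xpred0 = 0 -> (forall Z Z', Z =1 Z' -> Phi Z = Phi Z') ->
  \sum_t Phi [pred z | g z == t]
  = Phi [pred z | u z == None]
    + \sum_m \sum_a Phi [pred z | (u z == Some m) && (v z == a)].
Proof.
move=> inj_j gE Phi0 eqPhi.
rewrite (eq_bigr (fun t => Phi [pred z | j (omap (fun m => (m, v z)) (u z)) == t])).
  rewrite (sum_relabel (fun z => omap (fun m => (m, v z)) (u z)) inj_j Phi0 eqPhi).
  rewrite sum_option pair_bigA /=; congr (_ + _).
    by apply: eqPhi => z /=; case: (u z).
  by apply: eq_bigr => -[m a] _; apply: eqPhi => z /=; case: (u z).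
by move=> t _; apply: eqPhi => z /=; rewrite gE.
Qed.

(** * The subspace projectors as diagonal matrices *)

Section Subspaces.
Variables (R : realType) (l k : nat).
Local Notation n := (l * k * (l * k))%N.

Definition alice_outcome (z : 'I_n) : 'I_(l * k) := (mxtens_unindex z).1.
Definition bob_outcome (z : 'I_n) : 'I_(l * k) := (mxtens_unindex z).2.

Definition common_subspace (z : 'I_n) : option 'I_l :=
  if Defs.subspace (alice_outcome z) == Defs.subspace (bob_outcome z)
  then Some (Defs.subspace (alice_outcome z)) else None.

Lemma subspace_projE (m : 'I_l) x y :
  subspace_proj R k m x y = ((x == y) && (Defs.subspace x == m))%:R.
Proof.
rewrite summxE; case: (mxtens_indexP x) => m' i; rewrite /Defs.subspace mxtens_indexK.
rewrite (bigD1 i) //= [X in _ + X]big1 ?addr0 => [|i' ni].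
  rewrite mxE (can_eq (@mxtens_indexK _ _)) xpair_eqE eqxx andbT.
  by case: (m' =P m) => [->|]; rewrite ?andbT ?andbF // eq_sym.
by rewrite mxE (can_eq (@mxtens_indexK _ _)) xpair_eqE [i == i']eq_sym (negbTE ni) andbF.
Qed.

Lemma subspace_proj2E (m : 'I_l) :
  subspace_proj2 R k m = diag_mx (\row_z (common_subspace z == Some m)%:R).
Proof.
apply/matrixP => z w; case: (mxtens_indexP z) => x y; case: (mxtens_indexP w) => x' y'.
rewrite tensmxE !subspace_projE !mxE (can_eq (@mxtens_indexK _ _)) xpair_eqE.
rewrite /common_subspace /alice_outcome /bob_outcome mxtens_indexK /= -natrM mulnb.
rewrite mulrb; case: (x == x'); case: (y == y'); rewrite /= ?andbF //.
case: (Defs.subspace x =P Defs.subspace y) => [->|nxy] /=; first by rewrite andbb.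
by case: (Defs.subspace x =P m) => [<-|//]; case: eqP => // e; case: nxy.
Qed.

Lemma subspace_probE (rho : 'M[R[i]]_n) m :
  subspace_prob rho m =
  complex.Re (\sum_(z | common_subspace z == Some m) rho z z).
Proof.
rewrite /subspace_prob subspace_proj2E mul_diag_mx /mxtrace [in RHS]big_mkcond.
congr complex.Re; apply: eq_bigr => z _; rewrite !mxE.
by case: ifP; rewrite ?mul1r ?mul0r.
Qed.

Lemma subspace_stateE (rho : 'M[R[i]]_n) m z w :
  subspace_state rho m z w =
  if (common_subspace z == Some m) && (common_subspace w == Some m)
  then ((subspace_prob rho m)^-1)%:C%C * rho z w else 0.
Proof.
rewrite /subspace_state subspace_proj2E mul_diag_mx mul_mx_diag !mxE.
by case: eqP; case: eqP; rewrite /= ?(mul1r, mul0r, mulr1, mulr0).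
Qed.

End Subspaces.

(** * Rescaling of entropies on one subspace *)

Section OneSubspace.
Variables (R : realType) (l k e : nat) (m : 'I_l).
Local Notation n := (l * k * (l * k))%N.
Variables (rho : 'M[R[i]]_n) (psi tpsi : 'cV[R[i]]_(n * e)).
Hypothesis psiP : purifies psi rho.
Let p := subspace_prob rho m.

Lemma eve_state_prob0 (Z : pred 'I_n) : ~~ (0 < p) ->
  eve_state psi [pred z | (common_subspace z == Some m) && Z z] = 0.
Proof.
move=> p0; apply/matrixP => i j; rewrite eve_stateE mxE big1 // => z /andP[zm _].
rewrite (purifies_diag0 _ psiP) ?mul0r //.
have ge0 w : 0 <= complex.Re (rho w w).
  by have := purifies_diag_ge0 w psiP; rewrite lecE => /andP[].
(* The probability is a sum of nonnegative diagonal entries, so each of them, and with it every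
   amplitude, vanishes. *)
have: \sum_(z | common_subspace z == Some m) complex.Re (rho z z) == 0.
  rewrite eq_le sumr_ge0 // -Re_sum -subspace_probE.
  by rewrite andbT leNgt.
rewrite psumr_eq0 // => /allP/(_ z (mem_index_enum _)); rewrite zm => /eqP re0.
have := purifies_diag_ge0 z psiP; rewrite lecE => /andP[/eqP im0 _].
by apply/eqP; rewrite eq_complex re0 im0 !eqxx.
Qed.

Hypothesis p_gt0 : 0 < p.
Hypothesis tpsiP : purifies tpsi (subspace_state rho m).

(** The diagonal of the projected state is zero outside the [m]-th subspace, so its purification has
    no amplitudes there. *)
Lemma eve_state_subspace (Z : pred 'I_n) :
  eve_state tpsi [pred z | (common_subspace z == Some m) && Z z] = eve_state tpsi Z.
Proof.
apply/matrixP => i j; rewrite !eve_stateE big_mkcond [RHS]big_mkcond /=.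
apply: eq_bigr => z _; case: eqP => //= /eqP nzm; case: (Z z) => //.
by rewrite (purifies_diag0 _ tpsiP) ?mul0r // subspace_stateE (negbTE nzm).
Qed.

Lemma subspace_state_scale z w :
  common_subspace z == Some m -> common_subspace w == Some m ->
  rho z w = p%:C%C * subspace_state rho m z w.
Proof.
move=> zm wm; rewrite subspace_stateE zm wm /= mulrA -rmorphM /=.
by rewrite divff ?gt_eqF // mul1r.
Qed.

(** The scaling law shared by Eve's entropies and the outcome entropies; its correction is additive
    over disjoint events. *)
Definition rescaled (Phi Phi' : pred 'I_n -> R) := forall Z : pred 'I_n,
  Phi [pred z | (common_subspace z == Some m) && Z z]
  = p * Phi' Z - p * log2 p * complex.Re (\tr (eve_state tpsi Z)).

Lemma vn_entropy_rescaled :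
  rescaled (fun Z => vn_entropy (eve_state psi Z)) (fun Z => vn_entropy (eve_state tpsi Z)).
Proof.
move=> Z; rewrite -[in RHS](eve_state_subspace Z).
apply: vn_entropy_eve_state_scale psiP tpsiP _ => // z w /andP[zm _] /andP[wm _].
exact: subspace_state_scale.
Qed.

Lemma outcome_entropy_rescaled :
  rescaled (outcome_entropy psi) (outcome_entropy tpsi).
Proof.
move=> Z; apply: outcome_entropy_scale => //; rewrite -[in RHS](eve_state_subspace Z).
rewrite (mxtrace_eve_state _ psiP) (mxtrace_eve_state _ tpsiP) mulr_sumr.
by apply: eq_bigr => z /andP[zm _]; apply: subspace_state_scale.
Qed.

(** The values of [v] partition the outcomes, so the corrections add up to a quantity independent of
    [v]; this is why they cancel in conditional entropies. *)
Lemma sum_rescaled (A : finType) (v : 'I_n -> A) (Phi Phi' : pred 'I_n -> R) :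
  rescaled Phi Phi' ->
  \sum_a Phi [pred z | (common_subspace z == Some m) && (v z == a)]
  = p * \sum_a Phi' [pred z | v z == a]
    - p * log2 p * complex.Re (\tr (eve_state tpsi xpredT)).
Proof.
move=> resc; rewrite (eq_bigr _ (fun a _ => resc [pred z | v z == a])).
rewrite sumrB -!mulr_sumr -Re_sum; congr (_ - _ * complex.Re _).
rewrite -[LHS](raddf_sum (@mxtrace _ _)); congr (\tr _).
exact: (eve_state_partition tpsi v (fun=> tt) tt).
Qed.

End OneSubspace.

(** * The state of one round and the key rate bound *)

Lemma round_state_density (R : realType) (l k e : nat)
    (rho : 'M[R[i]]_(l * k * (l * k))) (psi : 'cV[R[i]]_(l * k * (l * k) * e)) :
  density rho -> purifies psi rho -> cq_density (round_state psi).
Proof.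
move=> [_ tr_rho] psiP; rewrite /round_state; split=> [t|].
  by rewrite measure_recordE; apply: gram_psd.
rewrite -tr_rho -(raddf_sum (@mxtrace _ _)) /=.
under eq_bigr do rewrite measure_recordE.
pose h (z : 'I_(l * k * (l * k))) := sift (mxtens_unindex z).1 (mxtens_unindex z).2.
rewrite [X in \tr X](eve_state_partition psi h (fun=> tt) tt).
exact: mxtrace_eve_state.
Qed.

Theorem theorem1 (R : realType) (k l e : nat) (hk : (1 <= k)%N) (hl : (1 <= l)%N)
    (rhoAB : 'M[R[i]]_(l * k * (l * k)))
    (psi : 'cV[R[i]]_(l * k * (l * k) * e))
    (tpsi : 'I_l -> 'cV[R[i]]_(l * k * (l * k) * e))
    (rhoAB_density : density rhoAB)
    (psi_purifies : purifies psi rhoAB)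
    (tpsi_purifies : forall m : 'I_l, 0 < subspace_prob rhoAB m ->
       purifies (tpsi m) (subspace_state rhoAB m))
    (key_rate_bound : devetak_winter_bound R) :
  ((\sum_(m < l)
      (if 0 < subspace_prob rhoAB m
       then subspace_prob rhoAB m * subspace_rate (keygen_state (tpsi m))
       else 0))%:E
   <= protocol_key_rate psi)%E.
Proof.
apply: le_trans (key_rate_bound _ _ _ _ _ (round_state_density rhoAB_density psi_purifies)).
rewrite lee_fin.
have roundE := measure_recordE (@sift l k) psi.
rewrite (cond_entropy_eve_state roundE) (cond_entropy_outcome roundE).
set n := (l * k * (l * k))%N.
pose u : 'I_n -> option 'I_l := @common_subspace l k.
pose offA (z : 'I_n) := offset (alice_outcome z).
pose offB (z : 'I_n) := offset (bob_outcome z).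
pose S (Z : pred 'I_n) := vn_entropy (eve_state psi Z).
pose H := outcome_entropy psi.
have eqS Z Z' : Z =1 Z' -> S Z = S Z' by move=> eZ; rewrite /S (eq_eve_state _ eZ).
have eqH Z Z' : Z =1 Z' -> H Z = H Z'.
  by move=> eZ; rewrite /H /outcome_entropy (eq_eve_state _ eZ).
have S0 Z : eve_state psi Z = 0 -> S Z = 0 by rewrite /S => ->; rewrite vn_entropy0.
have H0 : H xpred0 = 0 by rewrite /H outcome_entropy0 ?eve_state_pred0.
have Snone : S xpred0 = 0 by rewrite S0 ?eve_state_pred0.
(* The four sums run over the registers [(X', M)], [M], [(X', (Y', M))] and [(Y', M)], in this
   order; for [M] alone the label is the dummy [tt]. *)
rewrite (@sum_labels _ _ _ _ _ S u offA (fun o => (omap snd o, omap fst o))) //;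
  first last.
- by move=> z; rewrite /u /sift /common_subspace; case: ifP.
- by case=> [[? ?]|] [[? ?]|] //= [-> ->].
rewrite (@sum_labels _ _ _ _ _ S u (fun=> tt) (omap fst)) //; first last.
- by move=> z; rewrite /u /sift /common_subspace; case: ifP.
- by case=> [[? []]|] [[? []]|] //= [->].
rewrite (@sum_labels _ _ _ _ _ H u (fun z => (offA z, offB z))
  (fun o => (omap (fun t => t.2.1) o, (omap (fun t => t.2.2) o, omap fst o)))) //;
  first last.
- by move=> z; rewrite /u /sift /common_subspace; case: ifP.
- by case=> [[? [? ?]]|] [[? [? ?]]|] //= [-> -> ->].
rewrite (@sum_labels _ _ _ _ _ H u offB (fun o => (omap snd o, omap fst o))) //;
  first last.
- by move=> z; rewrite /u /sift /common_subspace; case: ifP.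
- by case=> [[? ?]|] [[? ?]|] //= [-> ->].
have addKl (a b c : R) : (a + b) - (a + c) = b - c by ring.
(* The discard terms cancel within each conditional entropy. What remains is an equality for each
   [m]; the inequality of the theorem comes from the Devetak-Winter bound alone. *)
rewrite !addKl -!sumrB le_eqVlt; apply/orP; left; apply/eqP/eq_bigr => m _.
case: ifPn => [p0 | p0]; last first.
  have sumS (A : finType) (v : 'I_n -> A) :
      \sum_a S [pred z | u z == Some m & v z == a] = 0.
    by apply: big1 => a _; rewrite S0 ?(eve_state_prob0 psi_purifies).
  have sumH (A : finType) (v : 'I_n -> A) :
      \sum_a H [pred z | u z == Some m & v z == a] = 0.
    by apply: big1 => a _; rewrite /H outcome_entropy0 ?(eve_state_prob0 psi_purifies).
  rewrite (sumS _ offA) (sumS _ (fun=> tt)) (sumH _ (fun z => (offA z, offB z))).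
  by rewrite (sumH _ offB) !subrr.
have tP := tpsi_purifies m p0.
have keygenE := measure_recordE (fun x y => (offset x, offset y)) (tpsi m).
have resS (A : finType) (v : 'I_n -> A) :=
  sum_rescaled v (vn_entropy_rescaled psi_purifies p0 tP).
have resH (A : finType) (v : 'I_n -> A) :=
  sum_rescaled v (outcome_entropy_rescaled psi_purifies p0 tP).
rewrite (resS _ offA) (resS _ (fun=> tt)) (resH _ (fun z => (offA z, offB z))).
rewrite (resH _ offB) /subspace_rate /keygen_state.
rewrite (cond_entropy_eve_state keygenE) (cond_entropy_outcome keygenE).
pose S' (Z : pred 'I_n) := vn_entropy (eve_state (tpsi m) Z).
(* Conditioning on Eve alone is conditioning on a trivial register, whose value [tt] is dropped from
   the label. *)
rewrite (@sum_relabel _ _ _ _ S' (fun x => (x, tt)) offA); first 1 last.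
- by move=> ? ? [].
- by rewrite /S' eve_state_pred0 vn_entropy0.
- by move=> Z Z' eZ; rewrite /S' (eq_eve_state _ eZ).
(* The same correction [c] occurs in all four sums and cancels in both differences. *)
have alg (p c a b x y : R) :
  p * (a - b - (x - y)) = p * a - c - (p * b - c) - (p * x - c - (p * y - c)) by ring.
exact: alg.
Qed.
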